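(* For every integer $n\geq 3$, $$\alpha_2(J(n,2)) \leq U(n),$$ where $U(n)$ is the explicit quantity defined as follows. Let $$ f(x)=\left\lfloor\frac{\binom{n}{2}(n-2)}{x}\right\rfloor, \qquad g(x)=4nx-10x+1 $$ for positive integers $x$, let $$ x_0=x_0(n):=-\frac{1}{8n-20}+\frac12\sqrt{\frac{n^2}{2}-\frac n4+\frac38+\frac{\frac{15n}{4}-\frac{73}{8}}{4n^2-20n+25}}, $$ and let $$ U(n):=\max\left\{\min\{f(\lfloor x_0\rfloor),g(\lfloor x_0\rfloor)\},\ \min\{f(\lceil x_0\rceil),g(\lceil x_0\rceil)\}\right\}. $$
   Context: All graphs are finite, simple and undirected. The Johnson graph $J(n,2)$ has as vertices the $2$-subsets of an $n$-element set, two vertices being adjacent if and only if their intersection has size exactly $1$. Two (distinct) edges of a graph are incident if they share a common vertex. A $t$-edge-coloring of a graph $G$ is a mapping $\varphi:E(G)\to\{1,2,\ldots,t\}$; it induces a partition of $E(G)$ into the color classes $\varphi^{-1}(i)$, $i\in\{1,\ldots,t\}$. It is proper if no two incident edges receive the same color, and complete if for every pair of distinct colors $i,j\in\{1,\ldots,t\}$ there exist two incident edges, one of color $i$ and one of color $j$. The achromatic index $\alpha_2(G)$ is the largest integer $t$ for which $G$ admits a proper and complete $t$-edge-coloring. *)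

(* Defs.v *)
From HB Require Import structures.
From mathcomp Require Import all_boot all_order all_algebra.
From mathcomp Require Import reals.

Set Implicit Arguments.
Unset Strict Implicit.
Unset Printing Implicit Defensive.

Import Order.TTheory GRing.Theory Num.Theory.

Record sgraph := SGraph {
  vertex :> finType;
  adj : rel vertex;
  adj_sym : symmetric adj;
  adj_irrefl : irreflexive adj
}.

Definition edges (G : sgraph) : {set {set G}} :=
  [set e : {set G} | [exists x, [exists y, adj x y && (e == [set x; y])]]].

Definition edge (G : sgraph) : finType := {e : {set G} | e \in edges G}.

Definition incident (G : sgraph) : rel (edge G) :=
  fun e1 e2 => (e1 != e2) && [exists v : G, (v \in val e1) && (v \in val e2)].

Section Colorings.
Variables (G : sgraph) (t : nat).
Implicit Type phi : {ffun edge G -> 'I_t}.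

Definition proper_coloring phi : bool :=
  [forall e1, [forall e2, incident e1 e2 ==> (phi e1 != phi e2)]].

Definition complete_coloring phi : bool :=
  [forall i : 'I_t, [forall j : 'I_t, (i != j) ==>
    [exists e1, [exists e2,
      [&& incident e1 e2, phi e1 == i & phi e2 == j]]]]].

End Colorings.

Definition has_proper_complete_coloring (G : sgraph) (t : nat) : bool :=
  [exists phi : {ffun edge G -> 'I_t},
     proper_coloring phi && complete_coloring phi].

(* The bound on t loses nothing: see achromatic_indexP. *)
Definition achromatic_index (G : sgraph) : nat :=
  \max_(t < #|edge G|.+2 | has_proper_complete_coloring G t) t.

Lemma incident_sym (G : sgraph) : symmetric (@incident G).
Proof.
move=> e1 e2; rewrite /incident eq_sym; congr (_ && _).
by apply: eq_existsb => v; rewrite andbC.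
Qed.

Lemma has_proper_complete_coloring_leq (G : sgraph) t :
  has_proper_complete_coloring G t -> t < #|edge G|.+2.
Proof.
case: t => [|[|t]] // /existsP[phi /andP[_ /forallP cphi]].
have surj (i : 'I_t.+2) : exists e, phi e == i.
  have [j ne_ij] : exists j : 'I_t.+2, i != j.
    have [->|ne0] := eqVneq i ord0; first by exists ord_max.
    by exists ord0.
  have /forallP/(_ j)/implyP/(_ ne_ij)/existsP[e1 /existsP[e2]] := cphi i.
  by case/and3P => _ He _; exists e1.
have inj : injective (fun i => xchoose (surj i)).
  move=> i j /= eqij.
  by rewrite -(eqP (xchooseP (surj i))) -(eqP (xchooseP (surj j))) eqij.
by have := leq_card _ inj; rewrite card_ord ltnS => /leqW.
Qed.

Lemma has_proper_complete_coloring_exists (G : sgraph) :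
  exists t, has_proper_complete_coloring G t.
Proof.
pose P t := [exists phi : {ffun edge G -> 'I_t}, proper_coloring phi].
have exP : exists t, P t.
  exists #|edge G|; apply/existsP; exists [ffun e => enum_rank e].
  apply/forallP => e1; apply/forallP => e2; apply/implyP => /andP[ne12 _].
  by rewrite !ffunE (inj_eq enum_rank_inj).
case: (ex_minnP exP) => t /existsP[phi pphi] mint; exists t.
apply/existsP; exists phi; rewrite pphi /=.
apply/forallP => i; apply/forallP => j; apply/implyP => ne_ij.
apply: contraT => none.
have {}none e1 e2 : incident e1 e2 -> phi e1 = i -> phi e2 = j -> False.
  move=> inc Ei Ej; case/negP: none.
  apply/existsP; exists e1; apply/existsP; exists e2.
  by rewrite inc Ei Ej !eqxx.
have pp e1 e2 : incident e1 e2 -> phi e1 <> phi e2.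
  by move=> inc; apply/eqP; move/forallP/(_ e1)/forallP/(_ e2)/implyP: pphi; apply.
case: t phi i j ne_ij pp none mint {pphi} => [phi []//|t] phi i j ne_ij pp none mint.
have {mint} : ~~ P t by apply/negP => /mint; rewrite ltnn.
case/negP; rewrite eq_sym in ne_ij.
have [i' def_i _] := unlift_some ne_ij.
apply/existsP; exists [ffun e => odflt i' (unlift j (phi e))].
apply/forallP => e1; apply/forallP => e2; apply/implyP => inc.
rewrite !ffunE; apply/eqP; have := pp _ _ inc.
case: unliftP => [k1|] E1; case: unliftP => [k2|] E2 /= ne Ek.
- by apply: ne; rewrite E1 E2 Ek.
- by apply: (none _ _ inc) => //; rewrite E1 Ek.
- by rewrite incident_sym in inc; apply: (none _ _ inc) => //; rewrite E2 -Ek.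
- by apply: ne; rewrite E1 E2.
Qed.

Lemma achromatic_indexP (G : sgraph) :
  has_proper_complete_coloring G (achromatic_index G) /\
  (forall t, has_proper_complete_coloring G t -> t <= achromatic_index G).
Proof.
split=> [|t Ht]; last first.
  have lt_t := has_proper_complete_coloring_leq Ht.
  exact: (@leq_bigmax_cond _ _ (fun t : 'I_ _ => t : nat) (Ordinal lt_t)).
have [t0 H0] := has_proper_complete_coloring_exists G.
have lt_t0 := has_proper_complete_coloring_leq H0.
by rewrite /achromatic_index (bigop.bigmax_eq_arg (Ordinal lt_t0)) //; case: arg_maxnP.
Qed.

Definition johnson2_vertex (n : nat) : finType := {A : {set 'I_n} | #|A| == 2}.

Definition johnson2_adj (n : nat) : rel (johnson2_vertex n) :=
  fun A B => #|val A :&: val B| == 1.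

Lemma johnson2_adj_sym n : symmetric (@johnson2_adj n).
Proof. by move=> A B; rewrite /johnson2_adj setIC. Qed.

Lemma johnson2_adj_irrefl n : irreflexive (@johnson2_adj n).
Proof. by move=> A; rewrite /johnson2_adj setIid (eqP (valP A)). Qed.

Definition johnson2 (n : nat) : sgraph :=
  SGraph (@johnson2_adj_sym n) (@johnson2_adj_irrefl n).

Section Bound.
Local Open Scope ring_scope.
Variables (R : realType) (n : nat).

Definition f (x : int) : int :=
  Num.floor ('C(n, 2)%:R * (n%:R - 2) / x%:~R : R).

Definition g (x : int) : int := 4 * n%:Z * x - 10 * x + 1.

Definition x0 : R :=
  - (1 / (8 * n%:R - 20)) +
  1 / 2 * Num.sqrt (n%:R ^+ 2 / 2 - n%:R / 4 + 3 / 8 +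
    (15 * n%:R / 4 - 73 / 8) / (4 * n%:R ^+ 2 - 20 * n%:R + 25)).

Definition U : int :=
  Num.max (Num.min (f (Num.floor x0)) (g (Num.floor x0)))
          (Num.min (f (Num.ceil x0)) (g (Num.ceil x0))).

End Bound.

(* Main.v *)
Require Import Defs.
From mathcomp Require Import all_boot all_order all_algebra.
From mathcomp Require Import reals.
From mathcomp Require Import zify ring lra.
Import Order.TTheory GRing.Theory Num.Theory.
Local Open Scope ring_scope.

(** Let phi be a complete coloring with t >= 2 colors and let x be the size of
    a smallest color class.  On the one hand the t classes are disjoint, so
    t * x is at most the number of edges, which is C(n,2)(n-2) in J(n,2)
    ([card_johnson2_edge_le]); hence t <= f x.  On the other hand J(n,2) is
    2(n-2)-regular, so an edge is incident to at most 2(2(n-2)-1) = 4n-10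
    others, and each of the t-1 other colors must occur among the edges
    incident to the chosen class; hence t <= (4n-10) x + 1 = g x.  This pair of
    estimates is [complete_coloring_bounds].

    It remains to see that min(f x, g x) <= U for every integer x > 0
    ([min_f_g_le_U]).  The real functions E / x (with E = C(n,2)(n-2)) and g
    are respectively decreasing and increasing, and x0 is exactly the point
    where they cross: it is the positive root of (4n-10) X^2 + X = E
    ([x0_root]).  To the left of x0 the minimum is therefore governed by g,
    which is largest at floor x0, and to the right by f, which is largest at
    ceil x0. *)

(** * Edges and incidence in a graph of bounded degree *)

Section BoundedDegree.
Local Open Scope nat_scope.
Variables (G : sgraph) (D : nat).
Hypothesis degree_le : forall v : G, #|[set w | adj v w]| <= D.

Definition star (v : G) : {set edge G} :=
  [set e : edge G | v \in val e].

Lemma edge_ends (e : edge G) : exists x y : G, adj x y /\ val e = [set x; y].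
Proof.
have := valP e; rewrite inE => /existsP[x /existsP[y /andP[xy /eqP ->]]].
by exists x, y.
Qed.

Lemma card_edge_ends (e : edge G) : #|val e| = 2.
Proof.
have [x [y [xy ->]]] := edge_ends e.
by rewrite cards2; case: eqP xy => // ->; rewrite adj_irrefl.
Qed.

Lemma card_star_le v : #|star v| <= D.
Proof.
apply: leq_trans (degree_le v).
rewrite -(card_imset _ val_inj).
apply: leq_trans (leq_imset_card (fun w => [set v; w]) _).
apply/subset_leq_card/subsetP => _ /imsetP[e ve ->]; move: ve; rewrite inE.
have [x [y [xy ->]]] := edge_ends e; rewrite !inE => /orP[]/eqP vE; subst v.
  by apply/imsetP; exists y; rewrite ?inE.
by apply/imsetP; exists x; rewrite ?inE 1?adj_sym // setUC.
Qed.

(** Double counting of the pairs (vertex, edge through it). *)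
Lemma handshake_le : 2 * #|edge G| <= #|G| * D.
Proof.
have -> : 2 * #|edge G| = \sum_(v : G) #|star v|.
  rewrite mulnC -sum_nat_const.
  under eq_bigr => e _ do rewrite -(card_edge_ends e) -sum1_card.
  rewrite (exchange_big_dep predT) //=.
  by apply: eq_bigr => v _; rewrite -sum1_card; apply: eq_bigl => e; rewrite inE.
by rewrite -sum_nat_const; apply: leq_sum => v _; apply: card_star_le.
Qed.

(** Every edge incident to e lies in the star of one of its two ends, and e
    itself is to be discounted from both stars. *)
Lemma card_incident_le (e : edge G) :
  #|[set e' | incident e e']| <= 2 * D.-1.
Proof.
have [x [y [_ eE]]] := edge_ends e.
have starD1 v : v \in val e -> #|star v :\ e| <= D.-1.
  move=> ve; have := card_star_le v; have es : e \in star v by rewrite inE.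
  by rewrite (cardsD1 e) es add1n; case: (D).
have sub : [set e' | incident e e'] \subset (star x :\ e) :|: (star y :\ e).
  apply/subsetP => e'; rewrite !inE eq_sym => /andP[-> /existsP[v]].
  by rewrite eE !inE /= => /andP[/orP[]/eqP-> ->] //; rewrite orbT.
have hx : #|star x :\ e| <= D.-1 by apply: starD1; rewrite eE set21.
have hy : #|star y :\ e| <= D.-1 by apply: starD1; rewrite eE set22.
apply: leq_trans (subset_leq_card sub) _.
by rewrite (leq_trans (leq_card_setU _ _)) // mul2n -addnn leq_add.
Qed.

(** The witness x is the size of a smallest color class: being smallest gives
    the first estimate, and meeting all t-1 other colors gives the second. *)
Lemma complete_coloring_bounds t (phi : {ffun edge G -> 'I_t}) :
    1 < t -> complete_coloring phi ->
  exists x, [/\ 0 < x, t * x <= #|edge G| & t <= 2 * D.-1 * x + 1].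
Proof.
move=> t1 cphi; have t0 : 0 < t by apply: ltnW.
pose cls i := [set e : edge G | phi e == i].
have meet i j : i != j ->
    exists e1 e2, [/\ incident e1 e2, phi e1 = i & phi e2 = j].
  move=> ij; have /forallP/(_ i)/forallP/(_ j)/implyP/(_ ij) := cphi.
  by move=> /existsP[e1 /existsP[e2 /and3P[inc /eqP ? /eqP ?]]]; exists e1, e2.
have [i _ imin] := @arg_minnP _ (Ordinal t0) xpredT (fun i => #|cls i|) isT.
exists #|cls i|; split.
- have [j ij] : exists j : 'I_t, i != j.
    case: (eqVneq i (Ordinal t0)) => [->|ne]; last by exists (Ordinal t0).
    by exists (Ordinal t1).
  have [e1 [_ [_ E _]]] := meet i j ij.
  by apply/card_gt0P; exists e1; rewrite inE E.
- have -> : #|edge G| = \sum_(j < t) #|cls j|.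
    rewrite -sum1_card (partition_big phi predT) //=; apply: eq_bigr => j _.
    by rewrite -sum1_card; apply: eq_bigl => e; rewrite inE.
  rewrite -[t in t * _]card_ord -sum_nat_const.
  by apply: leq_sum => j _; apply: imin.
(* Every other color occurs next to the class of i. *)
have sub : [set~ i] \subset
    \bigcup_(e in cls i) [set phi e' | e' in [set e' | incident e e']].
  apply/subsetP => j; rewrite !inE eq_sym => /meet[e1 [e2 [inc E1 E2]]].
  apply/bigcupP; exists e1; first by rewrite inE E1.
  by apply/imsetP; exists e2; rewrite ?inE.
have card_bigcup :
    #|\bigcup_(e in cls i) [set phi e' | e' in [set e' | incident e e']]|
    <= \sum_(e in cls i) 2 * D.-1.
  elim/big_rec2: _ => [|e m A _ IH]; first by rewrite cards0.
  rewrite (leq_trans (leq_card_setU _ _)) // leq_add //.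
  exact: leq_trans (leq_imset_card phi _) (card_incident_le e).
have := leq_trans (subset_leq_card sub) card_bigcup.
by rewrite cardsC1 card_ord sum_nat_const mulnC addn1
  -(leq_add2r 1) !addn1 prednK.
Qed.

End BoundedDegree.

(** * The Johnson graph *)

Section Johnson.
Local Open Scope nat_scope.
Variable n : nat.

Lemma card_johnson2 : #|johnson2 n| = 'C(n, 2).
Proof.
rewrite card_sub -[in RHS](card_ord n) -card_draws.
by apply: eq_card => A; rewrite !inE.
Qed.

(** A neighbor B of A is determined by the element of A that it keeps and by
    the element outside A that it adds. *)
Lemma johnson2_degree_le (A : johnson2 n) :
  #|[set B | adj A B]| <= 2 * (n - 2).
Proof.
have cA : #|val A| = 2 by apply/eqP; exact: (valP A).
rewrite -(card_imset _ val_inj).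
have -> : 2 * (n - 2) = #|setX (val A) (~: val A)|.
  by rewrite cardsX cA cardsCs setCK cA card_ord.
apply: leq_trans (leq_imset_card (fun p => [set p.1; p.2]) _).
apply/subset_leq_card/subsetP => _ /imsetP[B + ->].
rewrite inE /= /johnson2_adj => /cards1P[a AB].
have /cards1P[c BA] : #|val B :\: val A| == 1.
  have := cardsID (val A) (val B); rewrite setIC AB cards1 (eqP (valP B)); lia.
have := set11 a; rewrite -AB inE => /andP[aA _].
have := set11 c; rewrite -BA inE => /andP[cA' _].
apply/imsetP; exists (a, c); first by rewrite !inE aA cA'.
by rewrite /= -AB -BA setIC setID.
Qed.

Lemma card_johnson2_edge_le : #|edge (johnson2 n)| <= 'C(n, 2) * (n - 2).
Proof.
have := handshake_le (johnson2 n) (2 * (n - 2)) johnson2_degree_le.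
by rewrite card_johnson2 mulnCA leq_pmul2l.
Qed.

End Johnson.

(** * The crossing point of the two bounds *)

Section Crossing.
Variables (R : realType) (n : nat).
Hypothesis n_ge3 : (3 <= n)%N.

Lemma bin2_real : ('C(n, 2)%:R : R) = n%:R * (n%:R - 1) / 2.
Proof.
have : ('C(n, 2) * 2 = n * n.-1)%N by rewrite mulnC -mul_bin_diag bin1.
move=> /(congr1 (fun k => k%:R : R)); rewrite !natrM -subn1 natrB; last lia.
by move=> <-; field.
Qed.

Let E : R := 'C(n, 2)%:R * (n%:R - 2).

(** E / X = g X, cleared of its denominator, is the quadratic equation
    (4n-10) X^2 + X = E.  The quantity under the root in x0 is its
    discriminant 1 + 4(4n-10)E divided by (4n-10)^2, written out by polynomial
    division by (2n-5)^2. *)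
Lemma x0_root :
  0 < x0 R n /\ ((4 * n%:R - 10) * x0 R n + 1) * x0 R n = E.
Proof.
have n3 : (3 : R) <= n%:R by rewrite ler_nat.
rewrite /E bin2_real /x0; move: (n%:R : R) n3 => N n3.
have N25 : 2 * N - 5 != 0 by apply: lt0r_neq0; lra.
have N410 : 4 * N - 10 != 0 by apply: lt0r_neq0; lra.
have N820 : 8 * N - 20 != 0 by apply: lt0r_neq0; lra.
have Nsq : 4 * N ^+ 2 - 20 * N + 25 != 0.
  have -> : 4 * N ^+ 2 - 20 * N + 25 = (2 * N - 5) ^+ 2 by ring.
  exact: expf_neq0.
set Delta := (X in Num.sqrt X).
have DeltaE : Delta =
    (1 / (4 * N - 10)) ^+ 2 + 2 * N * (N - 1) * (N - 2) / (4 * N - 10).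
  by rewrite /Delta; field; rewrite ?N410 ?Nsq.
have Delta_gt : (1 / (4 * N - 10)) ^+ 2 < Delta.
  by rewrite DeltaE ltrDl divr_gt0 ?mulr_gt0 //; lra.
have sqrE : Num.sqrt Delta ^+ 2 = Delta.
  by rewrite sqr_sqrtr // (le_trans _ (ltW Delta_gt)) // sqr_ge0.
split.
  have : 1 / (4 * N - 10) < Num.sqrt Delta.
    by rewrite -(@ltr_pXn2r _ 2) ?nnegrE ?sqrtr_ge0 ?sqrE // divr_ge0 //; lra.
  have -> : 1 / (4 * N - 10) = 2 * (1 / (8 * N - 20)).
    by field; rewrite ?N410 ?N820.
  by lra.
move: (Num.sqrt Delta) sqrE => s; rewrite DeltaE => sqrE.
have -> : ((4 * N - 10) * (- (1 / (8 * N - 20)) + 1 / 2 * s) + 1) *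
    (- (1 / (8 * N - 20)) + 1 / 2 * s) =
    (4 * N - 10) / 4 * s ^+ 2 - 1 / (4 * (4 * N - 10)).
  by field; rewrite ?N410 ?N820.
by rewrite sqrE; field; rewrite ?N410.
Qed.

Lemma g_real (x : int) : (g n x)%:~R = (4 * n%:R - 10) * x%:~R + 1 :> R.
Proof. by rewrite /g !(rmorphD, rmorphN, rmorphM) /=; ring. Qed.

Lemma f_ge (x t : int) : 0 < x -> (t <= f R n x) = (t%:~R * x%:~R <= E).
Proof. by move=> x_gt0; rewrite /f floor_ge_int ler_pdivlMr // ltr0z. Qed.

Lemma g_le (x y : int) : x <= y -> g n x <= g n y.
Proof. by rewrite /g => xy; nia. Qed.

(** The quantity compared is X g X, which equals E at x0; comparing it at a
    rounding of x0 and at x0 therefore compares g with E / X at that rounding. *)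
Lemma gx_le (y z : R) : 0 <= y -> y <= z ->
  ((4 * n%:R - 10) * y + 1) * y <= ((4 * n%:R - 10) * z + 1) * z.
Proof.
move=> y_ge0 yz; have n3 : (3 : R) <= n%:R by rewrite ler_nat.
have c_ge0 : 0 <= 4 * n%:R - 10 :> R by lra.
by apply: ler_pM; rewrite ?addr_ge0 ?mulr_ge0 // lerD2r ler_wpM2l.
Qed.

Lemma min_f_g_le_U (x : int) : 0 < x -> Num.min (f R n x) (g n x) <= U R n.
Proof.
move=> x_gt0; have [x0_gt0 rootE] := x0_root.
have n3 : (3 : R) <= n%:R by rewrite ler_nat.
rewrite /U le_max; set a := Num.floor _; set b := Num.ceil _.
case: (leP x%:~R (x0 R n)) => hx.
  (* Left of the crossing: g x <= g a, and g a <= f a since a <= x0 *)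
  have xa : x <= a by rewrite floor_ge_int.
  have a_gt0 : 0 < a by apply: lt_le_trans xa.
  have aR : a%:~R <= x0 R n := floor_le _.
  have a0R : (0 : R) < a%:~R by rewrite ltr0z.
  apply/orP; left; rewrite le_min !ge_min (g_le _ _ xa) orbT andbT.
  suff gf : g n a <= f R n a by rewrite (le_trans (g_le _ _ xa) gf) orbT.
  by rewrite f_ge // g_real -rootE; apply: gx_le (ltW _) _.
(* Right of the crossing: f x <= f b, and f b <= g b since b >= x0 *)
have bx : b <= x by rewrite ceil_le_int ltW.
have bR : x0 R n <= b%:~R := ceil_ge _.
have b0R : (0 : R) < b%:~R by apply: lt_le_trans bR.
have b_gt0 : 0 < b by rewrite -(ltr0z R).
have E_ge0 : 0 <= E by rewrite mulr_ge0 // subr_ge0 (le_trans _ n3) // ler_nat.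
have fxb : f R n x <= f R n b.
  by rewrite /f le_floor // ler_wpM2l // lef_pV2 ?posrE ?ltr0z // ler_int.
apply/orP; right; rewrite le_min !ge_min fxb /=.
suff fg : f R n b <= g n b by rewrite (le_trans fxb fg).
rewrite -(ler_int R) g_real /f.
apply: le_trans (floor_le _) _; rewrite ler_pdivrMr // -/E -rootE.
exact: gx_le (ltW _) _.
Qed.

End Crossing.

Theorem theorem2p2 (R : realType) (n : nat) (hn : (3 <= n)%N) :
  (achromatic_index (johnson2 n))%:Z <= U R n.
Proof.
have [+ _] := achromatic_indexP (johnson2 n).
move: (achromatic_index _) => t /existsP[phi /andP[_ cphi]].
suff [x [x_gt0 tx tg]] : exists x, [/\ (0 < x)%N,
    (t * x <= 'C(n, 2) * (n - 2))%N & (t <= (4 * n - 10) * x + 1)%N].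
  apply: le_trans (@min_f_g_le_U R n hn x%:Z x_gt0).
  rewrite le_min f_ge //; apply/andP; split; last by rewrite /g; nia.
  by move: tx; rewrite -(ler_nat R) !natrM natrB //; lia.
case: (ltnP 1 t) => [t_gt1|t_le1]; last first.
  (* At most one color: x = 1 satisfies both estimates *)
  exists 1%N; split => //; last by lia.
  have : (0 < 'C(n, 2))%N by rewrite bin_gt0; lia.
  by nia.
have [x [x_gt0 tx tg]] :=
  complete_coloring_bounds _ _ (@johnson2_degree_le n) _ _ t_gt1 cphi.
exists x; split=> //; first exact: leq_trans tx (card_johnson2_edge_le n).
apply: leq_trans tg _; rewrite leq_add2r leq_mul2r; lia.
Qed.
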